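(* Let $m\ge 1/2$ and consider the wideband scalar Nakagami-$m$ fading system described in the context, in which $|H_k|^2$ has probability density $p(a)=a^{m-1}\exp(-ma)\,m^m/\Gamma(m)$ for $a\ge 0$. For every $\eta\ge 1$, the wideband outage exponent is $$\mathcal{E}(\eta)=m\cdot\left[\frac{1}{\eta}-1+\log(\eta)\right].$$
   Context: Setting. There are $K$ parallel channels $Y_k=H_kX_k+Z_k$, $k=1,\ldots,K$, with $Z_k\sim\mathcal{CN}(0,1)$, inputs $X_k\sim\mathcal{CN}(0,\rho/K)$ where $\rho>0$ is the total power, and i.i.d. fading coefficients $H_k$ (distribution not depending on $K$). The total achievable rate (in nats) is the random variable $$R(K,\rho)=\sum_{k=1}^K\log\left(1+\frac{\rho}{K}|H_k|^2\right).$$ For an energy per nat $\eta>0$, with target rate $r=\rho/\eta$, the wideband outage exponent is $$\mathcal{E}(\eta):=\lim_{K\to\infty}\frac{-\log\Pr[R(K,\rho)\le r]}{K}.$$ All logarithms are natural. *)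

(* Defs.v *)
From HB Require Import structures.
From mathcomp Require Import all_boot all_order all_algebra.
From mathcomp Require Import all_classical all_reals all_analysis.
From mathcomp Require Import complex.

Set Implicit Arguments.
Unset Strict Implicit.
Unset Printing Implicit Defensive.

Import Order.TTheory GRing.Theory Num.Theory.
Import numFieldNormedType.Exports.

Local Open Scope classical_set_scope.
Local Open Scope ring_scope.

(* The Borel sigma-algebra of C, carried by R[i] through the identification
   of C with R * R. *)
Definition complex_coord (R : realType) (z : R[i]) : R * R :=
  (complex.Re z, complex.Im z).

HB.instance Definition _ (R : realType) := isPointed.Build R[i] (0 : R[i]).
HB.instance Definition _ (R : realType) :=
  Measurable.copy R[i] (g_sigma_algebra_preimageType (@complex_coord R)).

(* |z| ^ 2, as an element of R: the norm `|z| lives in R[i]. *)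
Definition sqmod (R : realType) (z : R[i]) : R :=
  ComplexField.Normc.normc z ^+ 2.

(* Since the index type is finite and the A i range over all measurable sets
   (A i = setT is allowed), this includes the product rule for subfamilies. *)
Definition independent_RVs d d' (T : measurableType d) (T' : measurableType d')
    (R : realType) (P : probability T R) (I : finType)
    (X : I -> {RV P >-> T'}) : Prop :=
  forall A : I -> set T', (forall i, measurable (A i)) ->
    P (\bigcap_i (X i @^-1` A i)) = (\prod_i P (X i @^-1` A i))%E.

Definition iid_with_law d d' (T : measurableType d) (T' : measurableType d')
    (R : realType) (P : probability T R) (I : finType)
    (X : I -> {RV P >-> T'}) (Q : probability T' R) : Prop :=
  independent_RVs X /\
  forall i A, measurable A -> distribution P (X i) A = Q A.

Definition has_density d (T : measurableType d) (R : realType)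
    (P : probability T R) (X : T -> R) (p : R -> R) : Prop :=
  forall A : set R, measurable A ->
    P (X @^-1` A) = (\int[lebesgue_measure]_(a in A) (p a)%:E)%E.

Definition Gamma (R : realType) (m : R) : R :=
  \int[lebesgue_measure]_(t in `]0, +oo[) (t `^ (m - 1) * expR (- t)).

(* Density of |H|^2 under Nakagami-m fading. *)
Definition nakagami_density (R : realType) (m a : R) : R :=
  if 0 <= a then a `^ (m - 1) * expR (- m * a) * m `^ m / Gamma m else 0.

(* R(K, rho), in nats. *)
Definition total_rate d (T : measurableType d) (R : realType)
    (P : probability T R) (K : nat) (H : 'I_K -> {RV P >-> R[i]})
    (rho : R) (w : T) : R :=
  \sum_(k < K) ln (1 + rho / K%:R * sqmod (H k w)).

Definition outage_probability d (T : measurableType d) (R : realType)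
    (P : probability T R) (K : nat) (H : 'I_K -> {RV P >-> R[i]})
    (rho r : R) : \bar R :=
  P [set w | total_rate H rho w <= r].

(* For each number K of channels, H K is the family of the K fading
   coefficients, on a sample space that may depend on K. The target rate is
   r = rho / eta. The extended logarithm lne is used because lne 0 = -oo,
   whereas ln 0 = 0. *)
Definition normalized_log_outage (R : realType) (d : nat -> measure_display)
    (T : forall K, measurableType (d K)) (P : forall K, probability (T K) R)
    (H : forall K, 'I_K -> {RV (P K) >-> R[i]}) (rho eta : R) (K : nat)
    : \bar R :=
  (- lne (outage_probability (H K) rho (rho / eta)) * (K%:R^-1)%:E)%E.

Definition wideband_outage_exponent (R : realType) (d : nat -> measure_display)
    (T : forall K, measurableType (d K)) (P : forall K, probability (T K) R)
    (H : forall K, 'I_K -> {RV (P K) >-> R[i]}) (rho eta : R) : \bar R :=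
  lim (normalized_log_outage H rho eta K @[K --> \oo]).

(* Main.v *)
(** The Laplace transform of a Nakagami gain is (m / (m + t)) ^ m, and by independence the sum S of K gains has transform (m / (m + t)) ^ (K m).

Upper bound on the outage probability: the exponential Markov inequality for (K / rho) * R(K, rho) at t = m (eta - 1), whose Laplace transform per channel converges to that of the gain by dominated convergence.

Lower bound: ln (1 + x) <= x reduces it to P (S <= K / eta). Cramer's tilting argument is run on transforms only, without changing the measure: for t = m (eta' - 1) with eta' > eta, the parts of E exp (- t S) outside the window |S / K - 1 / eta'| <= 1 / eta - 1 / eta' are dominated by the transforms at t - u and t + u, exponentially smaller than the one at t for u small. Then eta' tends to eta. *)

Require Import Defs.
From HB Require Import structures.
From mathcomp Require Import all_boot all_order all_algebra.
From mathcomp Require Import all_classical all_reals all_analysis.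
From mathcomp Require Import measurable_realfun complex ring lra.

Import Order.TTheory GRing.Theory Num.Theory.
Import numFieldNormedType.Exports.

Local Open Scope classical_set_scope.
Local Open Scope ring_scope.

(** * Change of variables for weighted measures *)

Section transfer.
Local Open Scope ereal_scope.
Import HBNNSimple.

(** On each level set of [h] the integrand is a constant times [G], so the integral depends only on
    the [G]-weighted masses of preimages of sets in [Y]. *)
Lemma integral_nnsfun_comp_density {d d'} {T : measurableType d}
    {Y : measurableType d'} {R : realType} (mu : {measure set T -> \bar R})
    (phi : T -> Y) (G : T -> \bar R) (h : {nnsfun Y >-> R}) :
  measurable_fun [set: T] phi -> measurable_fun [set: T] G -> (forall x, 0 <= G x) ->
  \int[mu]_x ((h (phi x))%:E * G x) =
  \sum_(k \in range h)
    (k%:E * \int[mu]_(x in phi @^-1` (h @^-1` [set k])) G x).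
Proof.
move=> mphi mG G0.
have mB k : measurable (phi @^-1` (h @^-1` [set k])).
  by rewrite -[X in measurable X]setTI; exact: mphi.
have term0 k x : 0 <= (k * \1_(phi @^-1` (h @^-1` [set k])) x)%:E.
  rewrite lee_fin indicE; have [|_] := boolP (x \in _); last by rewrite mulr0.
  by rewrite inE /= => <-; rewrite mulr1.
transitivity (\int[mu]_x (\sum_(k \in range h)
    (k * \1_(phi @^-1` (h @^-1` [set k])) x)%:E * G x)).
  apply: eq_integral => x _; rewrite fimfunE -fsumEFin//.
  by rewrite ge0_mule_fsuml// => k; exact: term0.
rewrite ge0_integral_fsum//; last 2 first.
- move=> k; apply: emeasurable_funM => //; apply/measurable_EFinP.
  by apply: measurable_funM => //; exact: measurable_indic.
- by move=> k x _; rewrite mule_ge0.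
apply: eq_fsbigr => k /[!inE] -[y _ hyk].
have k0 : (0 <= k)%R by rewrite -hyk.
under eq_integral do rewrite EFinM -muleA.
rewrite ge0_integralZl//; last 2 first.
- apply: emeasurable_funM => //; apply/measurable_EFinP.
  exact: measurable_indic.
- by move=> x _; rewrite mule_ge0// lee_fin.
rewrite [in RHS]integral_mkcond; congr (_ * _); apply: eq_integral => x _.
rewrite patchE indicE; case: ifPn => _; by rewrite ?mul1e ?mul0e.
Qed.

(** Two weighted measures with the same image on [Y] integrate every nonnegative [f] alike: simple
    functions first, then monotone convergence. This one principle serves independence, scaling of
    Lebesgue measure, and densities. *)
Lemma ge0_integral_comp_density {d1 d2 d'} {T1 : measurableType d1}
    {T2 : measurableType d2} {Y : measurableType d'} {R : realType}
    (mu1 : {measure set T1 -> \bar R}) (mu2 : {measure set T2 -> \bar R})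
    (phi1 : T1 -> Y) (phi2 : T2 -> Y) (G1 : T1 -> \bar R) (G2 : T2 -> \bar R)
    (f : Y -> \bar R) :
  measurable_fun [set: T1] phi1 -> measurable_fun [set: T2] phi2 ->
  measurable_fun [set: T1] G1 -> measurable_fun [set: T2] G2 ->
  (forall x, 0 <= G1 x) -> (forall x, 0 <= G2 x) ->
  (forall B, measurable B ->
    \int[mu1]_(x in phi1 @^-1` B) G1 x = \int[mu2]_(x in phi2 @^-1` B) G2 x) ->
  measurable_fun [set: Y] f -> (forall y, 0 <= f y) ->
  \int[mu1]_x (f (phi1 x) * G1 x) = \int[mu2]_x (f (phi2 x) * G2 x).
Proof.
move=> mphi1 mphi2 mG1 mG2 G10 G20 E mf f0.
pose h := nnsfun_approx measurableT mf.
have lim_h d (T : measurableType d) (mu : {measure set T -> \bar R})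
    (phi : T -> Y) (G : T -> \bar R) : measurable_fun [set: T] phi ->
    measurable_fun [set: T] G -> (forall x, 0 <= G x) ->
    \int[mu]_x (f (phi x) * G x) =
    limn (fun n => \int[mu]_x ((h n (phi x))%:E * G x)).
  move=> mphi mG G0; rewrite -monotone_convergence//.
  - apply: eq_integral => x _; apply/esym/cvg_lim => //.
    have hf : (h n (phi x))%:E @[n --> \oo] --> f (phi x).
      by apply: cvg_nnsfun_approx.
    (* A product of limits may have the indeterminate form 0 * +oo, so zeros of [f] and of [G] are
       treated apart; where [f] vanishes, so do its approximations from below. *)
    have [fx0|fx0] := eqVneq (f (phi x)) 0.
      rewrite fx0 mul0e (_ : (fun n => _) = cst 0); first exact: cvg_cst.
      apply/funext => n /=.
      suff -> : (h n (phi x))%:E = 0 by rewrite mul0e.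
      apply/eqP; rewrite eq_le; apply/andP; split; last by rewrite lee_fin.
      by rewrite -fx0 /h nnsfun_approxE; apply: le_approx.
    have [Gx0|Gx0] := eqVneq (G x) 0.
      rewrite Gx0 mule0; under eq_fun do rewrite mule0.
      exact: cvg_cst.
    by apply: cvgeM hf (cvg_cst _); apply: neq0_mule_def; rewrite mule_neq0.
  - move=> n; apply: emeasurable_funM => //; apply/measurable_EFinP.
    exact: measurableT_comp.
  - by move=> n x _; rewrite mule_ge0// lee_fin.
  - move=> x _ a b ab; apply: lee_wpmul2r => //; rewrite lee_fin.
    exact/lefP/nd_nnsfun_approx.
rewrite !lim_h//; congr (limn _); apply/funext => n.
rewrite !integral_nnsfun_comp_density//.
by apply: eq_fsbigr => k _; rewrite E.
Qed.

End transfer.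

(** * Product formula for independent variables *)

Section independence.
Local Open Scope ereal_scope.

Lemma independent_RVs_integral_prod {d d'} {T : measurableType d}
    {T' : measurableType d'} {R : realType} (P : probability T R)
    (I : finType) (X : I -> {RV P >-> T'}) (f : I -> T' -> \bar R) :
  independent_RVs X ->
  (forall i, measurable_fun [set: T'] (f i)) -> (forall i y, 0 <= f i y) ->
  \int[P]_w \prod_i f i (X i w) = \prod_i \int[P]_w f i (X i w).
Proof.
move=> indX.
have mX i : measurable_fun [set: T] (X i) by [].
have mprod (r : seq I) (p : pred I) (g : I -> T' -> \bar R) :
    (forall i, measurable_fun [set: T'] (g i)) ->
    measurable_fun [set: T] (fun w => \prod_(i <- r | p i) g i (X i w)).
  move=> mg; elim: r => [|i r IH].
    by under eq_fun do rewrite big_nil; exact: measurable_cst.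
  under eq_fun do rewrite big_cons.
  case: (p i) => //; apply: emeasurable_funM => //.
  exact: measurableT_comp.
have indic_prod i B : measurable B -> \int[P]_w (\1_B (X i w))%:E = P (X i @^-1` B).
  move=> mB; have -> : (fun w => (\1_B (X i w))%:E) =
      (fun w => (\1_(X i @^-1` B) w)%:E) by [].
  rewrite integral_indic ?setIT//.
  by rewrite -[X in measurable X]setTI; exact: mX.
(* s lists the indices whose function is not yet known to be an indicator. *)
suff main (s : seq I) : forall g : I -> T' -> \bar R,
    (forall i, measurable_fun [set: T'] (g i)) -> (forall i y, 0 <= g i y) ->
    (forall i, i \notin s ->
      exists2 B, measurable B & g i = fun y => (\1_B y)%:E) ->
    \int[P]_w \prod_i g i (X i w) = \prod_i \int[P]_w g i (X i w).
  move=> mf f0; apply: (main (enum I)) => // i.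
  by rewrite mem_enum.
elim: s => [|j s IH] g mg g0 gs.
  (* With [s] empty every [g i] is the indicator of some [B i], and the claim is the definition of
     independence. *)
  pose B i := projT1 (cid2 (gs i isT)).
  have mB i : measurable (B i) by rewrite /B; case: cid2.
  have gB i : g i = fun y => (\1_(B i) y)%:E by rewrite /B; case: cid2.
  under [RHS]eq_bigr => i _ do rewrite gB indic_prod//.
  rewrite -indX//.
  have mcap : measurable (\bigcap_i (X i @^-1` B i)).
    apply: fin_bigcap_measurable => // i _.
    by rewrite -[X in measurable X]setTI; exact: mX.
  rewrite -[X in P X]setIT -integral_indic//.
  apply: eq_integral => w _.
  under eq_bigr do rewrite gB.
  rewrite prodEFin; congr EFin.
  rewrite indicE; have [|] := boolP (w \in _).
    rewrite inE => wB; rewrite big1// => i _.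
    by rewrite indicE mem_set//; exact: wB.
  rewrite notin_setE => wB.
  have [i Bi] : exists i, ~ B i (X i w).
    by apply: contrapT => /forallNP h; apply: wB => i _; apply: contrapT; apply: h.
  by rewrite (bigD1 i)//= indicE memNset ?mul0r.
pose c := \prod_(i | i != j) \int[P]_w g i (X i w).
have c0 : 0 <= c by apply: prode_ge0 => i _; exact: integral_ge0.
transitivity (\int[P]_w (g j (X j w) * c)); last first.
  rewrite ge0_integralZr//; last exact: measurableT_comp.
  by rewrite (bigD1 j).
under eq_integral do rewrite (bigD1 j)//=.
apply: ge0_integral_comp_density => //.
- exact: mprod.
- by move=> w; apply: prode_ge0.
move=> B mB.
(* With the indicator of [B] at index [j], only indices in [s] can be non-indicators, so the
   induction hypothesis applies. *)
pose g' i := if i == j then (fun y => (\1_B y)%:E) else g i.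
have E1 : \int[P]_w \prod_i g' i (X i w) = \prod_i \int[P]_w g' i (X i w).
  apply: IH => [i|i y|i is_].
  - rewrite /g'; case: eqP => // _.
    by apply/measurable_EFinP; exact: measurable_indic.
  - by rewrite /g'; case: eqP => // _; rewrite lee_fin.
  - rewrite /g'; case: eqVneq => [_|ij]; first by exists B.
    by apply: gs; rewrite inE negb_or ij.
have g'j : g' j = (fun y => (\1_B y)%:E) by rewrite /g' eqxx.
have g'N i : i != j -> g' i = g i by rewrite /g' => /negbTE ->.
rewrite integral_cst; last by rewrite -[X in measurable X]setTI; exact: mX.
rewrite muleC [X in X * _](_ : _ = \int[P]_w g' j (X j w)); last first.
  by rewrite g'j; exact/esym/indic_prod.
transitivity (\prod_i \int[P]_w g' i (X i w)); last first.
  rewrite (bigD1 j)//=; congr (_ * _).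
  by apply: eq_bigr => i ij; rewrite g'N.
rewrite -E1 integral_mkcond; apply: eq_integral => w _.
rewrite (bigD1 j)//= patchE g'j indicE.
under [in RHS]eq_bigr => i ij do rewrite g'N//.
have -> : (w \in X j @^-1` B) = (X j w \in B) by apply/idP/idP; rewrite !inE.
by case: ifPn => _; rewrite ?mul1e ?mul0e.
Qed.

Lemma iid_integral_prod {d d'} {T : measurableType d}
    {T' : measurableType d'} {R : realType} (P : probability T R)
    (K : nat) (X : 'I_K -> {RV P >-> T'}) (Q : probability T' R)
    (f : T' -> \bar R) :
  iid_with_law X Q -> measurable_fun [set: T'] f -> (forall y, 0 <= f y) ->
  \int[P]_w \prod_(k < K) f (X k w) = (\int[Q]_y f y) ^+ K.
Proof.
move=> [indX lawX] mf f0; rewrite (independent_RVs_integral_prod _ _ _ (fun=> f))//.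
have E i : \int[P]_w f (X i w) = \int[Q]_y f y.
  rewrite -(ge0_integral_distribution (X i))//.
  by apply: eq_measure_integral => A mA _; exact: lawX.
under eq_bigr do rewrite E.
by elim: K {X indX lawX E} => [|K IH]; rewrite ?big_ord0 ?big_ord_recl ?IH ?expeS.
Qed.

End independence.

(** * Laplace transform of the Nakagami gain *)

Section laplace.
Context {R : realType}.

Lemma measurable_sqmod : measurable_fun [set: R[i]] (@sqmod R).
Proof.
have -> : @sqmod R = (fun p : R * R => p.1 ^+ 2 + p.2 ^+ 2) \o @complex_coord R.
  apply/funext => -[a b]; rewrite /sqmod /complex_coord /= sqr_sqrtr//.
  by rewrite addr_ge0 ?sqr_ge0.
have mq : measurable_fun [set: R * R] (fun p : R * R => p.1 ^+ 2 + p.2 ^+ 2).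
  by apply: measurable_funD; exact: measurable_funX.
(* The sigma-algebra on [R[i]] consists of preimages under [complex_coord], so a measurable subset
   of the plane has to be exhibited. *)
move=> _ B mB; rewrite setTI.
exists ((fun p : R * R => p.1 ^+ 2 + p.2 ^+ 2) @^-1` B); last by rewrite setTI.
by rewrite -[X in measurable X]setTI; exact: mq.
Qed.

Lemma sqmod_ge0 (z : R[i]) : 0 <= sqmod z.
Proof. exact: sqr_ge0. Qed.

Lemma nakagami_density_ge0 (m a : R) : 0 <= nakagami_density m a.
Proof.
rewrite /nakagami_density; case: ifP => // _.
rewrite divr_ge0 ?mulr_ge0 ?powR_ge0 ?expR_ge0//.
by apply: Rintegral_ge0 => t _; rewrite mulr_ge0 ?powR_ge0 ?expR_ge0.
Qed.

Lemma measurable_nakagami_density (m : R) :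
  measurable_fun [set: R] (nakagami_density m).
Proof.
apply: measurable_fun_if => //.
  exact: measurable_fun_ler.
apply: measurable_funTS.
do 2 (apply: measurable_funM; last exact: measurable_cst).
apply: measurable_funM; first exact: measurable_powR.
apply: measurableT_comp => //; exact: measurable_funM.
Qed.

Local Open Scope ereal_scope.
Local Notation lambda := (@lebesgue_measure R).

(** The right-hand side is a measure in [A] that agrees with Lebesgue measure on half-open
    intervals, and uniqueness concludes. *)
Lemma lebesgue_measure_scale (s : R) (A : set R) : (0 < s)%R -> measurable A ->
  lambda A = s%:E * lambda ( *%R s @^-1` A).
Proof.
move=> s0 mA.
pose s' : {nonneg R} := NngNum (ltW s0).
rewrite -[RHS]/(pushforward (mscale s' lambda)
  ( *%R s : _ -> measurableTypeR R) A).
apply: lebesgue_measure_unique => //.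
move=> _ [[a b]] _ <-; rewrite /= /pushforward /mscale /=.
rewrite [X in _ * lambda X](_ : _ = `](a / s)%R, (b / s)%R]%classic); last first.
  by apply/seteqP; split=> x; rewrite /= !in_itv/= ltr_pdivrMr// ler_pdivlMr// (mulrC x).
rewrite !lebesgue_measure_itv/= !lte_fin ltr_pM2r ?invr_gt0//.
case: ifPn => _; last by rewrite mule0.
by rewrite -!EFinD -EFinM; congr EFin; field; rewrite gt_eqF.
Qed.

Lemma ge0_integral_lebesgue_scale (s : R) (f : R -> \bar R) : (0 < s)%R ->
  measurable_fun [set: R] f -> (forall x, 0 <= f x) ->
  \int[lambda]_x f x = s%:E * \int[lambda]_x f (s * x)%R.
Proof.
move=> s0 mf f0.
have ms : measurable_fun [set: R] ( *%R s) by exact: measurable_funM.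
rewrite -ge0_integralZl//; last 2 first.
- exact: measurableT_comp.
- by rewrite lee_fin ltW.
transitivity (\int[lambda]_x (f x * cst 1 x)).
  by apply: eq_integral => x _; rewrite mule1.
under [RHS]eq_integral do rewrite muleC.
apply: (@ge0_integral_comp_density _ _ _ (measurableTypeR R) (measurableTypeR R)
  R R lambda lambda idfun ( *%R s) (cst 1) (cst s%:E)) => //.
- exact: (@measurable_id _ R).
- by move=> x; rewrite lee_fin ltW.
- move=> B mB; have mB' : measurable ( *%R s @^-1` B).
    by rewrite -[X in measurable X]setTI; exact: ms.
  by rewrite !integral_cst// mul1e; exact: lebesgue_measure_scale.
Qed.

(** Rescaling by s = m / (m + theta) absorbs the exponential tilt: the integrand becomes s ^ (m - 1)
    times the density itself, whose mass is 1 because [Q] is a probability. The Gamma integral is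
    never evaluated. *)
Lemma nakagami_laplace (m theta : R) (Q : probability R[i] R) :
  (0 < m)%R -> (0 <= theta)%R -> has_density Q (@sqmod R) (nakagami_density m) ->
  \int[Q]_z (expR (- theta * sqmod z))%:E = ((m / (m + theta)) `^ m)%:E.
Proof.
move=> m0 theta0 dens.
have s0 : (0 < m / (m + theta))%R by rewrite divr_gt0// ltr_wpDr.
have mexp : measurable_fun [set: R] (fun a : R => (expR (- theta * a))%:E).
  apply/measurable_EFinP; apply: measurableT_comp => //; exact: measurable_funM.
have mp : measurable_fun [set: R] (fun a => (nakagami_density m a)%:E).
  by apply/measurable_EFinP; exact: measurable_nakagami_density.
transitivity (\int[Q]_z ((expR (- theta * sqmod z))%:E * cst 1 z)).
  by apply: eq_integral => z _; rewrite mule1.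
rewrite (@ge0_integral_comp_density _ _ _ R[i] (measurableTypeR R) R R Q lambda (@sqmod R) idfun
  (cst 1) (fun a => (nakagami_density m a)%:E)
  (fun a : R => (expR (- theta * a))%:E))//; last 4 first.
- exact: measurable_sqmod.
- exact: (@measurable_id _ R).
- by move=> a; rewrite lee_fin nakagami_density_ge0.
- move=> B mB; have mB' : measurable (@sqmod R @^-1` B).
    by rewrite -[X in measurable X]setTI; exact: measurable_sqmod.
  by rewrite integral_cst// mul1e; exact: dens.
rewrite (ge0_integral_lebesgue_scale _ _ s0); last 2 first.
- exact: emeasurable_funM.
- by move=> x; rewrite mule_ge0 ?lee_fin ?expR_ge0 ?nakagami_density_ge0.
transitivity ((m / (m + theta))%:E * \int[lambda]_x
   (((m / (m + theta)) `^ (m - 1))%:E * (nakagami_density m x)%:E)).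
  congr (_ * _); apply: eq_integral => x _; rewrite -!EFinM; congr EFin.
  rewrite /nakagami_density pmulr_rge0//=; case: ifPn => [x0|_]; last by rewrite !mulr0.
  rewrite powRM ?(ltW s0)//.
  have -> : expR (- m * x) = (expR (- theta * (m / (m + theta) * x)) *
                              expR (- m * (m / (m + theta) * x)))%R.
    rewrite -expRD; congr expR; field.
    by rewrite gt_eqF// ltr_wpDr.
  ring.
rewrite ge0_integralZl//; last 2 first.
- by move=> x _; rewrite lee_fin nakagami_density_ge0.
- by rewrite lee_fin powR_ge0.
have := dens _ measurableT; rewrite preimage_setT probability_setT => <-.
by rewrite mule1 -EFinM mulr_powRB1// ltW.
Qed.

End laplace.

(** * Exponential Markov inequality and window estimate *)

Section chernoff.
Context {d : measure_display} {T : measurableType d} {R : realType}.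
Variables (P : probability T R) (S : T -> R).
Hypothesis mS : measurable_fun [set: T] S.

Let mexpS (c : R) : measurable_fun [set: T] (fun w => (expR (c * S w))%:E).
Proof.
apply/measurable_EFinP; apply: measurableT_comp => //; exact: measurable_funM.
Qed.

Let mle (s : R) : measurable [set w | S w <= s].
Proof.
have -> : [set w | S w <= s] = S @^-1` `]-oo, s]%classic.
  by apply/seteqP; split => w /=; rewrite in_itv.
by rewrite -[X in measurable X]setTI; exact: mS.
Qed.

Lemma chernoff_lower_tail (theta s : R) : 0 <= theta ->
  (P [set w | (S w <= s)%R] <=
   (expR (theta * s))%:E * \int[P]_w (expR (- theta * S w))%:E)%E.
Proof.
move=> theta0; rewrite -[X in P X]setIT -integral_indic//.
rewrite -ge0_integralZl//.
apply: ge0_le_integral => //.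
- by apply/measurable_EFinP; exact: measurable_indic.
- exact: measurable_funeM.
move=> w _; rewrite -EFinM -expRD lee_fin indicE.
have [|_] := boolP (w \in _); last by rewrite expR_ge0.
rewrite inE /= => Sws; rewrite -expR0 ler_expR mulNr -mulrBr.
by rewrite mulr_ge0// subr_ge0.
Qed.

(** The bound holds pointwise: exp (- theta S) is at most the [M1] integrand when S > b, the [M2]
    integrand when S < a, and exp (- theta a) in between, where the indicator equals 1. *)
Lemma laplace_window_le (theta tau a b M0 M1 M2 : R) :
  0 <= theta -> 0 <= tau ->
  (\int[P]_w (expR (- theta * S w))%:E = M0%:E)%E ->
  (\int[P]_w (expR (- (theta - tau) * S w))%:E = M1%:E)%E ->
  (\int[P]_w (expR (- (theta + tau) * S w))%:E = M2%:E)%E ->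
  (M0%:E <= (expR (- (theta * a)))%:E * P [set w | (S w <= b)%R] +
           ((expR (- (tau * b)))%:E * M1%:E + (expR (tau * a))%:E * M2%:E))%E.
Proof.
move=> theta0 tau0 <- <- <-.
have mI : measurable_fun [set: T]
    (fun w => (\1_[set w | (S w <= b)%R] w)%:E : \bar R).
  by apply/measurable_EFinP; exact: measurable_indic.
have Z c x : ((expR c)%:E * \int[P]_w (expR (x * S w))%:E =
    \int[P]_w ((expR c)%:E * (expR (x * S w))%:E))%E by rewrite ge0_integralZl.
have mZ c x : measurable_fun [set: T]
    (fun w => ((expR c)%:E * (expR (x * S w))%:E)%E) by exact: measurable_funeM.
rewrite -[X in P X]setIT -integral_indic// !Z -ge0_integralZl//.
rewrite -ge0_integralD//.
have mD : measurable_fun [set: T] (fun w =>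
    ((expR (- (tau * b)))%:E * (expR (- (theta - tau) * S w))%:E +
     (expR (tau * a))%:E * (expR (- (theta + tau) * S w))%:E)%E).
  exact: emeasurable_funD.
have D0 w : (0 <= (expR (- (tau * b)))%:E * (expR (- (theta - tau) * S w))%:E +
     (expR (tau * a))%:E * (expR (- (theta + tau) * S w))%:E)%E.
  by rewrite adde_ge0// mule_ge0 ?lee_fin ?expR_ge0.
have mZI : measurable_fun [set: T] (fun w =>
    ((expR (- (theta * a)))%:E * (\1_[set w | (S w <= b)%R] w)%:E)%E).
  exact: measurable_funeM.
rewrite -ge0_integralD//.
apply: ge0_le_integral => //; first exact: emeasurable_funD.
move=> w _; rewrite -!EFinM -!EFinD lee_fin -!expRD indicE.
have [Swb|bSw] := leP (S w) b; last first.
  apply: (@le_trans _ _ (expR (- (tau * b) + - (theta - tau) * S w))).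
    rewrite ler_expR; nra.
  by rewrite addrCA lerDl addr_ge0 ?expR_ge0// mulr_ge0 ?expR_ge0.
have -> : w \in [set w | (S w <= b)%R] by rewrite inE.
rewrite mulr1.
have [Swa|aSw] := ltP (S w) a.
  apply: (@le_trans _ _ (expR (tau * a + - (theta + tau) * S w))).
    rewrite ler_expR; nra.
  by rewrite addrA lerDr addr_ge0 ?expR_ge0.
apply: (@le_trans _ _ (expR (- (theta * a)))); first by rewrite ler_expR; nra.
by rewrite lerDl addr_ge0 ?expR_ge0.
Qed.

End chernoff.

(** * Estimates on logarithms *)

Section real_bounds.
Context {R : realType}.
Implicit Types (m a rho : R).

Lemma ln_le_subr1 (x : R) : 0 < x -> ln x <= x - 1.
Proof.
move=> x0; have := @le_ln1Dx R (x - 1); rewrite addrCA subrr addr0; apply.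
by rewrite ltrBrDl subrr.
Qed.

(** The cumulant function of the gain at - t. *)
Definition log_laplace m (t : R) := m * (ln m - ln (m + t)).

Lemma powR_laplace m (t : R) : 0 < m -> 0 <= t ->
  (m / (m + t)) `^ m = expR (log_laplace m t).
Proof.
move=> m0 t0; have mt0 : 0 < m + t by rewrite ltr_wpDr.
by rewrite /log_laplace /powR gt_eqF ?divr_gt0// ln_div.
Qed.

(** The derivative of [log_laplace m] at [theta] is - m / (m + theta), so first-order terms cancel
    up to - tau * eps, and for small [tau] half of this survives the second-order error. *)
Lemma log_laplace_gap m (theta eps : R) : 0 < m -> 0 < theta -> 0 < eps ->
  exists tau kappa : R, [/\ 0 < tau, tau <= theta, 0 < kappa,
    log_laplace m (theta - tau) - tau * (m / (m + theta) + eps)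
      <= log_laplace m theta - kappa &
    log_laplace m (theta + tau) + tau * (m / (m + theta) - eps)
      <= log_laplace m theta - kappa].
Proof.
move=> m0 theta0 eps0; rewrite /log_laplace.
set b := m + theta; have b0 : 0 < b by rewrite addr_gt0.
(* The bounds keep theta - tau nonnegative, b - tau at least b / 2, and the error factor m * tau /
   (b * (b - tau)) at most eps / 2. *)
pose tau := Num.min theta (Num.min (b / 2) (eps * b ^+ 2 / (4 * m))).
have tau0 : 0 < tau.
  by rewrite !lt_min theta0 !divr_gt0 ?mulr_gt0 ?exprn_gt0.
have tau_theta : tau <= theta by rewrite ge_min lexx.
have tau_b : tau <= b / 2 by rewrite !ge_min lexx !orbT.
have tau_eps : tau <= eps * b ^+ 2 / (4 * m) by rewrite !ge_min lexx !orbT.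
have {}tau_eps : 4 * m * tau <= eps * b ^+ 2.
  by rewrite mulrC -ler_pdivlMr ?mulr_gt0.
have bt0 : 0 < b - tau by lra.
have bT0 : 0 < b + tau by lra.
exists tau, (tau * eps / 2); split => //; first by rewrite !mulr_gt0.
- have -> : m + (theta - tau) = b - tau by rewrite /b addrA.
  have h1 : ln b - ln (b - tau) <= tau / (b - tau).
    rewrite -ln_div//; apply: le_trans (ln_le_subr1 _ (divr_gt0 b0 bt0)) _.
    by rewrite le_eqVlt; apply/orP; left; apply/eqP; field; rewrite gt_eqF.
  have h2 : m * (tau / (b - tau)) - tau * (m / b) <= tau * eps / 2.
    have -> : m * (tau / (b - tau)) - tau * (m / b) =
              tau * (m * tau / (b * (b - tau))).
      by field; rewrite !gt_eqF.
    rewrite -[leRHS]mulrA; apply: ler_wpM2l; first exact: ltW.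
    have h3 : 0 <= eps * b * (b / 2 - tau).
      by rewrite mulr_ge0 ?subr_ge0// mulr_ge0 ?ltW.
    rewrite ler_pdivrMr ?mulr_gt0//; nra.
  have := ler_wpM2l (ltW m0) h1; lra.
- have -> : m + (theta + tau) = b + tau by rewrite /b addrA.
  have h1 : ln b - ln (b + tau) <= - (tau / (b + tau)).
    rewrite -ln_div//; apply: le_trans (ln_le_subr1 _ (divr_gt0 b0 bT0)) _.
    by rewrite le_eqVlt; apply/orP; left; apply/eqP; field; rewrite gt_eqF.
  have h2 : - (m * (tau / (b + tau))) + tau * (m / b) <= tau * eps / 2.
    have -> : - (m * (tau / (b + tau))) + tau * (m / b) =
              tau * (m * tau / (b * (b + tau))).
      by field; rewrite !gt_eqF.
    rewrite -[leRHS]mulrA; apply: ler_wpM2l; first exact: ltW.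
    have h3 : 0 <= eps * b * tau by rewrite !mulr_ge0// ltW.
    rewrite ler_pdivrMr ?mulr_gt0//; nra.
  have := ler_wpM2l (ltW m0) h1; lra.
Qed.

(* Normalised so that its limit as K tends to infinity is the gain a. *)
Definition linearized_rate rho (K : nat) a :=
  K%:R / rho * ln (1 + rho / K%:R * a).

Lemma linearized_rate_ge0 rho (K : nat) a : 0 < rho -> 0 <= a ->
  0 <= linearized_rate rho K a.
Proof.
move=> rho0 a0; rewrite mulr_ge0 ?divr_ge0 ?ler0n ?(ltW rho0)//.
by rewrite ln_ge0// lerDl mulr_ge0 ?divr_ge0 ?ler0n ?(ltW rho0).
Qed.

Lemma cvg_linearized_rate rho a : 0 < rho -> 0 <= a ->
  linearized_rate rho K a @[K --> \oo] --> a.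
Proof.
(* The shift discards K = 0, where rho / K is a junk value. *)
move=> rho0 a0; rewrite -cvg_shiftS /=.
apply: (@squeeze_cvgr _ _ _ _ (fun n => a - rho * a ^+ 2 * n.+1%:R^-1)
  (cst a)).
- apply: nearW => n; rewrite /linearized_rate /=.
  have n0 : 0 < n.+1%:R :> R by rewrite ltr0n.
  set N : R := n.+1%:R in n0 *.
  have x0 : 0 <= rho / N * a by rewrite mulr_ge0// divr_ge0// ltW.
  set x := rho / N * a in x0 *.
  have x1 : 0 < 1 + x by lra.
  have aE : a = N / rho * x by rewrite /x; field; rewrite !gt_eqF.
  have c0 : 0 <= N / rho by rewrite divr_ge0// ltW.
  apply/andP; split.
    have -> : a - rho * a ^+ 2 * N^-1 = N / rho * (x - x ^+ 2).
      by rewrite /x; field; rewrite !gt_eqF.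
    apply: ler_wpM2l => //.
    (* Applied to the inverse, ln y <= y - 1 gives ln (1 + x) >= x / (1 + x) >= x - x ^ 2. *)
    have := ln_le_subr1 (1 + x)^-1; rewrite invr_gt0 => /(_ x1).
    rewrite lnV// => h.
    have : 1 - (1 + x)^-1 >= x - x ^+ 2.
      have -> : 1 - (1 + x)^-1 = x / (1 + x) by field; rewrite gt_eqF.
      by rewrite ler_pdivlMr//; nra.
    lra.
  rewrite /= [leRHS]aE; apply: ler_wpM2l => //.
  by apply: le_ln1Dx; lra.
- rewrite -[X in _ --> X]subr0 -[X in _ --> _ - X](mulr0 (rho * a ^+ 2)).
  apply: cvgB; first exact: cvg_cst.
  by apply: cvgM; [exact: cvg_cst|exact: cvg_harmonic].
- exact: cvg_cst.
Qed.

End real_bounds.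

(** * Limit of the per-channel transform *)

Section wideband.
Context {R : realType}.

(** The integrands converge pointwise and, the exponents being nonpositive, are dominated by the
    constant 1. *)
Lemma cvg_laplace_linearized_rate (Q : probability R[i] R) (rho theta : R) :
  0 < rho -> 0 <= theta ->
  (\int[Q]_z (expR (- theta * linearized_rate rho K (sqmod z)))%:E @[K --> \oo]
    --> \int[Q]_z (expR (- theta * sqmod z))%:E)%E.
Proof.
move=> rho0 theta0.
apply: (@dominated_cvg _ _ _ Q setT measurableT
  (fun K z => (expR (- theta * linearized_rate rho K (sqmod z)))%:E) _ (cst 1%E)).
- move=> K; apply/measurable_EFinP; apply: measurableT_comp => //.
  apply: measurable_funM => //; apply: measurable_funM => //.
  apply: measurableT_comp; first exact: measurable_ln.
  apply: measurable_funD => //; apply: measurable_funM => //.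
  exact: measurable_sqmod.
- move=> z _; apply: cvg_EFin; first exact: nearW.
  apply: continuous_cvg; first exact: continuous_expR.
  by apply: cvgM; [exact: cvg_cst|exact: cvg_linearized_rate (sqmod_ge0 z)].
- by [].
- exact: finite_measure_integrable_cst.
- move=> K z _; rewrite abse_EFin lee_fin ger0_norm ?expR_ge0//.
  rewrite -expR0 ler_expR mulNr oppr_le0 mulr_ge0//.
  by rewrite linearized_rate_ge0// sqmod_ge0.
Qed.

(** * Outage bounds for a fixed number of channels *)

Section outage.
Context {d : measure_display} {T : measurableType d}.
Variables (P : probability T R) (K : nat) (H : 'I_K -> {RV P >-> R[i]}).
Variables (Q : probability R[i] R) (rho : R).
Hypothesis (H_iid : iid_with_law H Q) (rho_gt0 : 0 < rho).

Let measurable_sum_sqmod (g : R -> R) : measurable_fun [set: R] g ->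
  measurable_fun [set: T] (fun w => \sum_(k < K) g (sqmod (H k w))).
Proof.
move=> mg; apply: measurable_sum => k; apply: measurableT_comp => //.
by apply: measurableT_comp => //; exact: measurable_sqmod.
Qed.

Let measurable_rate (c : R) : measurable_fun [set: R] (fun a => ln (1 + c * a)).
Proof.
apply: measurableT_comp; first exact: measurable_ln.
by apply: measurable_funD => //; exact: measurable_funM.
Qed.

Lemma measurable_outage (r : R) : measurable [set w | total_rate H rho w <= r].
Proof.
have -> : [set w | total_rate H rho w <= r] =
    total_rate H rho @^-1` `]-oo, r]%classic.
  by apply/seteqP; split => w /=; rewrite in_itv.
rewrite -[X in measurable X]setTI.
exact: (measurable_sum_sqmod _ (measurable_rate (rho / K%:R))).
Qed.

Lemma iid_mgf (g : R -> R) (t : R) : measurable_fun [set: R] g ->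
  (\int[P]_w (expR (- t * \sum_(k < K) g (sqmod (H k w))))%:E =
   (\int[Q]_z (expR (- t * g (sqmod z)))%:E) ^+ K)%E.
Proof.
move=> mg; pose f z : \bar R := (expR (- t * g (sqmod z)))%:E.
have mf : measurable_fun [set: R[i]] f.
  apply/measurable_EFinP; apply: measurableT_comp => //.
  apply: measurable_funM => //; apply: measurableT_comp => //.
  exact: measurable_sqmod.
rewrite -(iid_integral_prod _ _ _ _ f H_iid mf); last first.
  by move=> z; rewrite lee_fin expR_ge0.
by apply: eq_integral => w _; rewrite mulr_sumr expR_sum prodEFin.
Qed.

Lemma outage_probability_le (theta eta : R) : 0 <= theta -> (0 < K)%N ->
  (outage_probability H rho (rho / eta) <=
   (expR (theta * (K%:R / eta)))%:E *
   (\int[Q]_z (expR (- theta * linearized_rate rho K (sqmod z)))%:E) ^+ K)%E.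
Proof.
move=> theta0 K0; have KR : 0 < K%:R :> R by rewrite ltr0n.
have mlin : measurable_fun [set: R] (linearized_rate rho K).
  by apply: measurable_funM => //; exact: measurable_rate.
rewrite -(iid_mgf _ _ mlin) /outage_probability.
(* Both sides of the outage inequality are multiplied by K / rho. *)
have -> : [set w | total_rate H rho w <= rho / eta] =
    [set w | \sum_(k < K) linearized_rate rho K (sqmod (H k w)) <= K%:R / eta].
  apply/funext => w; rewrite /= /linearized_rate -mulr_sumr.
  rewrite -[in LHS](ler_pM2l (divr_gt0 KR rho_gt0)).
  by rewrite [K%:R / rho * (rho / eta)]mulrA divfK ?gt_eqF.
exact: (chernoff_lower_tail _ _ (measurable_sum_sqmod _ mlin)).
Qed.

Lemma outage_probability_ge_sum (eta : R) : (0 < K)%N ->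
  (P [set w | (\sum_(k < K) sqmod (H k w) <= K%:R / eta)%R] <=
   outage_probability H rho (rho / eta))%E.
Proof.
move=> K0; have KR : 0 < K%:R :> R by rewrite ltr0n.
apply: le_measure; rewrite ?inE; last 2 first.
- exact: measurable_outage.
- move=> w /= Sw; apply: (@le_trans _ _ (rho / K%:R * \sum_(k < K) sqmod (H k w))).
    rewrite /total_rate mulr_sumr; apply: ler_sum => k _; apply: le_ln1Dx.
    apply: (@lt_le_trans _ _ 0); first exact: ltrN10.
    by rewrite mulr_ge0 ?sqmod_ge0// divr_ge0 ?ler0n// ltW.
  have := ler_wpM2l (ltW (divr_gt0 rho_gt0 KR)) Sw.
  by rewrite [rho / K%:R * (K%:R / eta)]mulrA divfK ?gt_eqF.
have -> : [set w | \sum_(k < K) sqmod (H k w) <= K%:R / eta] =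
    (fun w => \sum_(k < K) sqmod (H k w)) @^-1` `]-oo, K%:R / eta]%classic.
  by apply/seteqP; split => w /=; rewrite in_itv.
rewrite -[X in measurable X]setTI.
exact: (measurable_sum_sqmod id).
Qed.

(** The window for S is [K (c - eps), K (c + eps)] with c = m / (m + theta), its upper end being K /
    eta. Each tail takes at most a quarter of the transform at [theta], which leaves half for the
    window. *)
Lemma outage_probability_ge (m theta eps eta : R) : 0 < m ->
  has_density Q (@sqmod R) (nakagami_density m) -> (0 < K)%N ->
  forall tau kappa : R, 0 < tau -> tau <= theta -> 0 < kappa ->
  m / (m + theta) + eps = eta^-1 ->
  log_laplace m (theta - tau) - tau * (m / (m + theta) + eps)
      <= log_laplace m theta - kappa ->
  log_laplace m (theta + tau) + tau * (m / (m + theta) - eps)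
      <= log_laplace m theta - kappa ->
  ln 4 <= K%:R * kappa ->
  ((expR (K%:R * (log_laplace m theta + theta * (m / (m + theta) - eps))) / 2)%:E
   <= outage_probability H rho (rho / eta))%E.
Proof.
move=> m0 dens K0 tau kappa tau0 tau_theta kappa0 etaE gap1 gap2 K_large.
have KR : 0 < K%:R :> R by rewrite ltr0n.
set c := m / (m + theta) in etaE gap1 gap2 *.
have theta0 : 0 <= theta by apply: le_trans tau_theta; exact: ltW.
have mgf t : 0 <= t -> (\int[P]_w (expR (- t * \sum_(k < K) sqmod (H k w)))%:E =
    (expR (K%:R * log_laplace m t))%:E)%E.
  move=> t0; rewrite (iid_mgf id)// (nakagami_laplace _ _ _ m0 t0 dens).
  by rewrite powR_laplace// -EFin_expe expRM_natl.
have mS : measurable_fun [set: T] (fun w => \sum_(k < K) sqmod (H k w)).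
  exact: (measurable_sum_sqmod id).
have tt0 : 0 <= theta - tau by rewrite subr_ge0.
have tT0 : 0 <= theta + tau by rewrite addr_ge0// ltW.
have := laplace_window_le P _ mS theta tau (K%:R * (c - eps)) (K%:R / eta) _ _ _
  theta0 (ltW tau0) (mgf _ theta0) (mgf _ tt0) (mgf _ tT0).
set p := P _ => main.
apply: le_trans (outage_probability_ge_sum eta K0); rewrite -/p.
have pfin : p \is a fin_num.
  apply: fin_num_measure.
  have -> : [set w | \sum_(k < K) (sqmod (H k w)) <= K%:R / eta] =
    (fun w => \sum_(k < K) sqmod (H k w)) @^-1` `]-oo, K%:R / eta]%classic.
    by apply/seteqP; split => w /=; rewrite in_itv.
  by rewrite -[X in measurable X]setTI; exact: mS.
rewrite -(fineK pfin) lee_fin.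
move: main; rewrite -(fineK pfin) -!EFinM -!EFinD lee_fin -!expRD.
set q := fine p; set L := log_laplace m theta in gap1 gap2 *.
(* The exponential gap K * kappa is at least ln 4, hence the factor 1 / 4. *)
have small x : x <= K%:R * (L - kappa) -> expR x <= expR (K%:R * L) / 4.
  move=> xL; rewrite -[leRHS]lnK ?posrE ?divr_gt0 ?expR_gt0// ler_expR.
  rewrite ln_div ?posrE ?expR_gt0// expRK; lra.
have h1 : expR (- (tau * (K%:R / eta)) + K%:R * log_laplace m (theta - tau))
    <= expR (K%:R * L) / 4.
  apply: small; rewrite -etaE.
  have := ler_wpM2l (ltW KR) gap1; lra.
have h2 : expR (tau * (K%:R * (c - eps)) + K%:R * log_laplace m (theta + tau))
    <= expR (K%:R * L) / 4.
  by apply: small; have := ler_wpM2l (ltW KR) gap2; lra.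
move=> main.
have {}main : expR (K%:R * L) / 2 <= expR (- (theta * (K%:R * (c - eps)))) * q by lra.
have -> : K%:R * (L + theta * (c - eps)) = K%:R * L + theta * (K%:R * (c - eps)) by ring.
rewrite expRD mulrAC -ler_pdivlMr ?expR_gt0// -expRN [leRHS]mulrC.
exact: main.
Qed.

End outage.
End wideband.

(** * From exponential bounds to the exponent *)

Section exponent.
Context {R : realType}.

(** The two bounds make [p K] eventually finite and positive, so that [lne] is a real logarithm and
    monotonicity of [ln] puts the exponent within [delta] of [rate]. *)
Lemma cvg_log_exponent (p : nat -> \bar R) (rate : R) :
  (forall delta : R, 0 < delta -> \forall K \near \oo,
    ((expR (- (K%:R * (rate + delta))))%:E <= p K)%E) ->
  (forall delta : R, 0 < delta -> \forall K \near \oo,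
    (p K <= (expR (- (K%:R * (rate - delta))))%:E)%E) ->
  (- lne (p K) * (K%:R^-1)%:E @[K --> \oo] --> rate%:E)%E.
Proof.
move=> lower upper.
have close (delta : R) : 0 < delta -> \forall K \near \oo,
    exists2 r : R, (- lne (p K) * (K%:R^-1)%:E = r%:E)%E & `|rate - r| <= delta.
  move=> delta0; near=> K.
  have K0 : 0 < K%:R :> R by rewrite ltr0n; near: K; exact: nbhs_infty_gt.
  have low : ((expR (- (K%:R * (rate + delta))))%:E <= p K)%E.
    by near: K; exact: lower.
  have up : (p K <= (expR (- (K%:R * (rate - delta))))%:E)%E.
    by near: K; exact: upper.
  have pfin : p K \is a fin_num.
    rewrite ge0_fin_numE ?(le_lt_trans up) ?ltry//.
    by apply: le_trans low; rewrite lee_fin expR_ge0.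
  move: low up; rewrite -(fineK pfin) !lee_fin => low up.
  have q0 : 0 < fine (p K) by apply: lt_le_trans low; exact: expR_gt0.
  exists (- ln (fine (p K)) / K%:R); first by rewrite lne_EFin.
  have := low; rewrite -ler_ln ?posrE ?expR_gt0// expRK => low'.
  have := up; rewrite -ler_ln ?posrE ?expR_gt0// expRK => up'.
  rewrite ler_norml; apply/andP; split.
    by rewrite lerBrDr addrC -lerBrDr opprK ler_pdivrMr//; lra.
  by rewrite lerBlDr addrC -lerBlDr ler_pdivlMr//; lra.
apply: cvg_EFin.
  have := close 1 ltr01; apply: filterS => K [r -> _] //.
apply/cvgrPdist_le => delta delta0.
by have := close delta delta0; apply: filterS => K [r /= -> ?].
Unshelve. all: by end_near. Qed.

End exponent.

(** * The Nakagami outage exponent *)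

Theorem mainTheorem7 (R : realType) (m rho : R)
    (d : nat -> measure_display) (T : forall K : nat, measurableType (d K))
    (P : forall K : nat, probability (T K) R)
    (H : forall K : nat, 'I_K -> {RV (P K) >-> R[i]})
    (Q : probability R[i] R)
    (m_ge : 1 / 2 <= m) (rho_gt0 : 0 < rho)
    (H_iid : forall K : nat, iid_with_law (H K) Q)
    (Q_nakagami : has_density Q (@sqmod R) (nakagami_density m))
    (eta : R) (eta_ge1 : 1 <= eta) :
  cvg (normalized_log_outage H rho eta K @[K --> \oo]) /\
  wideband_outage_exponent H rho eta = (m * (1 / eta - 1 + ln eta))%:E.
Proof.
suff cv : normalized_log_outage H rho eta K @[K --> \oo] -->
    (m * (1 / eta - 1 + ln eta))%:E.
  by split; [exact: cvgP cv | exact: cvg_lim cv].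
have m0 : 0 < m by apply: lt_le_trans m_ge; rewrite divr_gt0.
have eta0 : 0 < eta by apply: lt_le_trans eta_ge1.
apply: cvg_log_exponent => delta delta0.
(* Moving from eta to eta * (1 + t) costs at most 2 * m * t = delta / 2 in the exponent; the other
   delta / 2 absorbs the prefactor 1 / 2 for large K. *)
- pose t := delta / (4 * m).
  have t0 : 0 < t by rewrite divr_gt0// mulr_gt0.
  pose eta' := eta * (1 + t).
  have t1 : 1 < 1 + t by rewrite ltrDl.
  have eta_lt : eta < eta' by rewrite ltr_pMr.
  have eta'0 : 0 < eta' by apply: lt_trans eta_lt.
  (* This tilt moves the mean gain to m / (m + theta) = 1 / eta'; it is positive even at eta = 1, as
     [log_laplace_gap] requires. *)
  pose theta := m * (eta' - 1).
  have theta0 : 0 < theta by rewrite mulr_gt0// subr_gt0 (le_lt_trans eta_ge1).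
  have mtheta : m + theta = m * eta' by rewrite /theta; ring.
  pose eps := eta^-1 - eta'^-1.
  have eps0 : 0 < eps by rewrite subr_gt0 ltf_pV2.
  have cE : m / (m + theta) = eta'^-1.
    by rewrite mtheta; field; rewrite !gt_eqF.
  have [tau [kappa [tau0 tau_theta kappa0 gap1 gap2]]] :=
    log_laplace_gap m theta eps m0 theta0 eps0.
  near=> K.
  have K0 : (0 < K)%N by near: K; exact: nbhs_infty_gt.
  have KR : 0 < K%:R :> R by rewrite ltr0n.
  have K4 : ln 4 <= K%:R * kappa.
    rewrite -ler_pdivrMr//; near: K; exact: nbhs_infty_ger.
  have K2 : ln 2 <= K%:R * (delta / 2).
    rewrite -ler_pdivrMr ?divr_gt0//; near: K; exact: nbhs_infty_ger.
  apply: le_trans (outage_probability_ge (P K) K (H K) Q rho (H_iid K) rho_gt0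
    m theta eps eta m0 Q_nakagami K0 tau kappa tau0 tau_theta kappa0 _
    gap1 gap2 K4); last by rewrite cE /eps addrCA subrr addr0.
  rewrite lee_fin -[leRHS]lnK ?posrE ?divr_gt0 ?expR_gt0// ler_expR.
  rewrite ln_div ?posrE ?expR_gt0// expRK cE.
  have lE : log_laplace m theta = - (m * (ln eta + ln (1 + t))).
    rewrite /log_laplace mtheta !lnM ?posrE// ?(lt_trans ltr01)//; ring.
  have lnt : ln (1 + t) <= t by apply: le_ln1Dx; lra.
  have E : theta * (eta'^-1 - eps) =
      m * ((1 - t) - (1 - t) / (1 + t) / eta).
    by rewrite /theta /eps /eta'; field; rewrite !gt_eqF//; lra.
  have tt : (1 - t) / (1 + t) / eta <= 1 / eta.
    rewrite ler_pM2r ?invr_gt0// ler_pdivrMr; lra.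
  have mt : m * t = delta / 4.
    by rewrite /t; field; rewrite gt_eqF.
  rewrite E lE.
  have h1 := ler_wpM2l (ltW m0) lnt.
  have h2 := ler_wpM2l (ltW m0) tt.
  have : - (m * (ln eta + ln (1 + t))) + m * (1 - t - (1 - t) / (1 + t) / eta)
    >= - (m * (1 / eta - 1 + ln eta)) - delta / 2 by lra.
  move/(ler_wpM2l (ltW KR)); lra.
(* This minimises theta / eta + m * ln (m / (m + theta)), the limiting Chernoff exponent; eta >= 1
   makes it nonnegative. *)
- pose theta := m * (eta - 1).
  have theta0 : 0 <= theta by rewrite mulr_ge0 ?subr_ge0// ltW.
  have mtheta : m + theta = m * eta by rewrite /theta; ring.
  pose e K := (\int[Q]_z (expR (- theta * linearized_rate rho K (sqmod z)))%:E)%E.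
  have : (e K @[K --> \oo] --> \int[Q]_z (expR (- theta * sqmod z))%:E)%E.
    exact: cvg_laplace_linearized_rate.
  rewrite (nakagami_laplace _ _ _ m0 theta0 Q_nakagami) powR_laplace//.
  have -> : log_laplace m theta = - (m * ln eta).
    by rewrite /log_laplace mtheta lnM ?posrE//; ring.
  move=> /fine_cvgP[efin ecvg].
  have lt_exp : expR (- (m * ln eta)) < expR (- (m * ln eta) + delta).
    by rewrite ltr_expR ltrDl.
  near=> K.
  have K0 : (0 < K)%N by near: K; exact: nbhs_infty_gt.
  have KR : 0 < K%:R :> R by rewrite ltr0n.
  apply: le_trans (outage_probability_le (P K) K (H K) Q rho (H_iid K) rho_gt0
    theta eta theta0 K0) _.
  rewrite -/(e K).
  have eK : e K \is a fin_num by near: K; exact: efin.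
  have e0 : (0 <= e K)%E by apply: integral_ge0 => z _; rewrite lee_fin expR_ge0.
  (* The per-channel transform only converges, so it is bounded with slack [delta] before the K-th
     power is taken. *)
  have le : fine (e K) <= expR (- (m * ln eta) + delta).
    by near: K; apply: (cvgr_le (expR (- (m * ln eta)))).
  rewrite -(fineK eK) -EFin_expe -EFinM lee_fin.
  apply: (@le_trans _ _ (expR (theta * (K%:R / eta)) *
    expR (- (m * ln eta) + delta) ^+ K)).
    rewrite ler_pM2l ?expR_gt0// lerXn2r// nnegrE ?expR_ge0// fine_ge0//.
  rewrite -expRM_natl -expRD ler_expR le_eqVlt; apply/orP; left; apply/eqP.
  by rewrite /theta; field; rewrite gt_eqF.
Unshelve. all: by end_near. Qed.
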